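(* Consider a dynamic network $w = Gw + Rr + He$ with node index set $\{1,\dots,L\}$, and let $G_{ji}$ (with $i\neq j$) be the module of interest. Let $\{1,\dots,L\}=\tilde{\mathcal S}\cup\mathcal L\cup\mathcal V\cup\tilde{\mathcal Z}$ be a partition into disjoint sets such that $\{i,j\}\subset\tilde{\mathcal S}$ and such that the nodes $w_{\mathcal L}$ serve as indirect observations of the nodes $w_{\mathcal V}$, i.e. $G_{\mathcal L\mathcal V}+G_{\mathcal L\tilde{\mathcal Z}}(I-G_{\tilde{\mathcal Z}\tilde{\mathcal Z}})^{-1}G_{\tilde{\mathcal Z}\mathcal V}$ has full column rank. Let $\breve G_{ji}(q,\tilde{\mathcal S},\mathcal L,\mathcal V,\tilde{\mathcal Z})$ denote the module from $w_i$ to $w_j$ in the abstracted network obtained by the abstraction algorithm (described in the context) with the sets $\tilde{\mathcal S},\mathcal L,\mathcal V,\tilde{\mathcal Z}$. Define $\mathcal J=\{j\}\cup\mathcal L$ and $\mathcal K=(\mathcal V\cup\tilde{\mathcal S})\setminus\{j\}$. Then $$\breve G_{ji}(q,\tilde{\mathcal S},\mathcal L,\mathcal V,\tilde{\mathcal Z})=G_{ji}(q)$$ if the following two conditions are satisfied: (a) all paths from $w_i$ to nodes in $w_{\mathcal J}$, excluding the direct path $G_{ji}$, pass through a node $w_k$ with $k\in\mathcal K\setminus\{i\}$; (b) all paths from $w_j$ to nodes in $w_{\mathcal J}$ (including loops from $w_j$ to $w_j$) pass through a node $w_k$ with $k\in\mathcal K$.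
   Context: Dynamic network: $L$ scalar node signals $w=[w_1\cdots w_L]^T$ and external signals $r=[r_1\cdots r_K]^T$ satisfy $w(t)=G(q)w(t)+u(t)+v(t)$, where $u=R(q)r$, $v=H(q)e$ with $e$ white noise, $q^{-1}$ is the delay operator, and $G,R,H$ are matrices of real rational (proper) transfer functions; $G$ has zero diagonal (no self-loops). The entries $G_{jl}$ are called modules. For index sets $\mathcal A,\mathcal B$, $w_{\mathcal A}$ is the vector of $w_a$, $a\in\mathcal A$, and $G_{\mathcal A\mathcal B}$ is the submatrix with entries $G_{ab}$, $a\in\mathcal A$, $b\in\mathcal B$. The network is well-posed, and all inverses used in the algorithm below are assumed to exist (as inverses of rational functions/matrices). Graph: there is a link from $w_k$ to $w_j$ iff $G_{jk}\neq0$. A path from $w_a$ to $w_b$ is a sequence of at least two nodes starting at $w_a$ and ending at $w_b$ with a link from each node to the next; a loop is a path that starts and ends at the same node. The direct path $G_{ji}$ is the path consisting of the single link from $w_i$ to $w_j$. Partitioned network: with the four sets $\tilde{\mathcal S},\mathcal L,\mathcal V,\tilde{\mathcal Z}$ (any of $\mathcal L,\mathcal V,\tilde{\mathcal Z}$ may be empty), write the network as four block equations, namely $w_{\mathcal A}=G_{\mathcal A\tilde{\mathcal S}}w_{\tilde{\mathcal S}}+G_{\mathcal A\mathcal L}w_{\mathcal L}+G_{\mathcal A\mathcal V}w_{\mathcal V}+G_{\mathcal A\tilde{\mathcal Z}}w_{\tilde{\mathcal Z}}+u_{\mathcal A}+v_{\mathcal A}$ for $\mathcal A=\tilde{\mathcal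 S}$ (first), $\mathcal L$ (second), $\mathcal V$ (third), $\tilde{\mathcal Z}$ (fourth). The nodes in $\mathcal S=\tilde{\mathcal S}\cup\mathcal L$ are retained, those in $\mathcal Z=\mathcal V\cup\tilde{\mathcal Z}$ are removed. Abstraction algorithm: (a) Solve the fourth equation for $w_{\tilde{\mathcal Z}}$, substitute the result into the other equations, and remove the fourth equation. This gives coefficients $G^{(1)}_{\mathcal A\mathcal B}=G_{\mathcal A\mathcal B}+G_{\mathcal A\tilde{\mathcal Z}}(I-G_{\tilde{\mathcal Z}\tilde{\mathcal Z}})^{-1}G_{\tilde{\mathcal Z}\mathcal B}$ for $\mathcal A,\mathcal B\in\{\tilde{\mathcal S},\mathcal L,\mathcal V\}$. (b) Solve the resulting second equation (that of $w_{\mathcal L}$) for $w_{\mathcal V}$ using a left inverse $(G^{(1)}_{\mathcal L\mathcal V})^\dagger$ of $G^{(1)}_{\mathcal L\mathcal V}$, and substitute the result into the first equation. (c) Solve the resulting third equation (that of $w_{\mathcal V}$, from step (a)) for $w_{\mathcal V}$ using $(I-G^{(1)}_{\mathcal V\mathcal V})^{-1}$, substitute the result into the second equation (in its form from step (a)), and remove the third equation. (d) Remove self-loops: in each scalar equation for a retained node $w_k$, shift the term in $w_k$ on the right-hand side to the left-hand side and divide the equation so that $w_k$ alone remains on the left. The outcome is the abstracted network, a set of equations for $w_{\tilde{\mathcal S}}$ and $w_{\mathcal L}$ in terms of $w_{\tilde{\mathcal S}},w_{\mathcal L}$ and transformed $u,v$; its modules are denoted $\breve G_{kl}$. *)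

(* Defs.v *)
From HB Require Import structures.
From mathcomp Require Import all_boot all_order all_algebra.
From mathcomp Require Import reals.
Set Implicit Arguments.
Unset Strict Implicit.
Unset Printing Implicit Defensive.
Import Order.TTheory GRing.Theory Num.Theory.
Local Open Scope ring_scope.

(* Real rational transfer functions, as fractions of polynomials in the
   forward shift q. *)
Definition ratfun (R : realType) := {fraction {poly R}}.

(* deg a <= deg b; recall that size is degree + 1, and size 0 = 0. *)
Definition proper_ratfun (R : realType) (f : ratfun R) : Prop :=
  exists a b : {poly R},
    [/\ b != 0, (size a <= size b)%N & f = tofrac a / tofrac b].

Definition proper_mx (R : realType) (m n : nat) (M : 'M[ratfun R]_(m, n)) : Prop :=
  forall i j, proper_ratfun (M i j).

(* w = G w + u + v with u = R r and v = H e.  Well-posedness: I - G has a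
   proper rational inverse.  The signals occur only through the transfer
   functions that act on them. *)
Record dynamic_network (R : realType) (n nr ne : nat) := DynamicNetwork {
  net_G : 'M[ratfun R]_n;
  net_R : 'M[ratfun R]_(n, nr);
  net_H : 'M[ratfun R]_(n, ne);
  net_G_proper : proper_mx net_G;
  net_R_proper : proper_mx net_R;
  net_H_proper : proper_mx net_H;
  net_no_self_loop : forall k, net_G k k = 0;
  net_well_posed : 1%:M - net_G \in unitmx /\ proper_mx (invmx (1%:M - net_G))
}.

(* G k l is the module from node l to node k. *)
Definition link (F : fieldType) (n : nat) (G : 'M[F]_n) : rel 'I_n :=
  fun l k => G k l != 0.

(* The node sequence a :: p is a path from a to b; nodes may be repeated. *)
Definition is_path (F : fieldType) (n : nat) (G : 'M[F]_n) (a b : 'I_n)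
    (p : seq 'I_n) : bool :=
  [&& p != [::], path (link G) a p & last a p == b].

(* Blocks of the partition may be empty, unlike with finset's partition. *)
Definition is_partition4 (n : nat) (A B C D : {set 'I_n}) : Prop :=
  [/\ A :|: B :|: C :|: D = [set: 'I_n],
      [disjoint A & B] /\ [disjoint C & D] &
      [disjoint A :|: B & C :|: D]].

Definition sel_rows (F : fieldType) (n m : nat) (A : {set 'I_n})
    (M : 'M[F]_(n, m)) : 'M[F]_(#|A|, m) :=
  rowsub (@enum_val _ (mem A)) M.

Definition sel_cols (F : fieldType) (n m : nat) (A : {set 'I_n})
    (M : 'M[F]_(m, n)) : 'M[F]_(m, #|A|) :=
  colsub (@enum_val _ (mem A)) M.

Definition submx_of (F : fieldType) (n : nat) (G : 'M[F]_n)
    (A B : {set 'I_n}) : 'M[F]_(#|A|, #|B|) :=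
  mxsub (@enum_val _ (mem A)) (@enum_val _ (mem B)) G.

(* G_AB + G_AZ (I - G_ZZ)^-1 G_ZB *)
Definition G1 (F : fieldType) (n : nat) (G : 'M[F]_n) (Z A B : {set 'I_n})
    : 'M[F]_(#|A|, #|B|) :=
  submx_of G A B
  + submx_of G A Z *m invmx (1%:M - submx_of G Z Z) *m submx_of G Z B.

Definition zero_cols (F : fieldType) (n m : nat) (A : {set 'I_n})
    (M : 'M[F]_(m, n)) : 'M[F]_(m, n) :=
  \matrix_(a, l) (if l \in A then 0 else M a l).

(* The block of scalar equations w_A = wcoef w + xcoef (u + v), where w, u, v
   are the full vectors over all nodes, and the a-th row is the equation of
   node enum_val a. *)
Record block_eq (F : fieldType) (n : nat) (A : {set 'I_n}) := BlockEq {
  wcoef : 'M[F]_(#|A|, n);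
  xcoef : 'M[F]_(#|A|, n)
}.

Definition original_eq (F : fieldType) (n : nat) (G : 'M[F]_n)
    (A : {set 'I_n}) : block_eq F A :=
  BlockEq (sel_rows A G) (sel_rows A 1%:M).

(* Solve the equation of w_A for w_A. *)
Definition solve_self (F : fieldType) (n : nat) (A : {set 'I_n})
    (e : block_eq F A) : block_eq F A :=
  let K := invmx (1%:M - sel_cols A (wcoef e)) in
  BlockEq (K *m zero_cols A (wcoef e)) (K *m xcoef e).

(* Solve the equation of w_A for w_B with a left inverse D of the coefficient
   of w_B: w_B = D (w_A - (terms in the other nodes) - xcoef (u + v)). *)
Definition solve_other (F : fieldType) (n : nat) (A B : {set 'I_n})
    (D : 'M[F]_(#|B|, #|A|)) (e : block_eq F A) : block_eq F B :=
  BlockEq (D *m (sel_rows A 1%:M - zero_cols B (wcoef e))) (- (D *m xcoef e)).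

(* Substitute the expression s for w_B into e. *)
Definition substitute (F : fieldType) (n : nat) (A B : {set 'I_n})
    (e : block_eq F A) (s : block_eq F B) : block_eq F A :=
  let C := sel_cols B (wcoef e) in
  BlockEq (zero_cols B (wcoef e) + C *m wcoef s) (xcoef e + C *m xcoef s).

Definition self_coef (F : fieldType) (n : nat) (A : {set 'I_n})
    (e : block_eq F A) (a : 'I_#|A|) : F :=
  wcoef e a (enum_val a).

Definition remove_self_loops (F : fieldType) (n : nat) (A : {set 'I_n})
    (e : block_eq F A) : block_eq F A :=
  BlockEq
    (\matrix_(a, l) (if l == enum_val a then 0
                     else wcoef e a l / (1 - self_coef e a)))
    (\matrix_(a, l) (xcoef e a l / (1 - self_coef e a))).

(* Elimination of w_Z from the equation of w_A. *)
Definition step_a (F : fieldType) (n : nat) (G : 'M[F]_n) (Z A : {set 'I_n})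
    : block_eq F A :=
  substitute (original_eq G A) (solve_self (original_eq G Z)).

(* Equation of w_S after w_V is eliminated through the equation of w_L, with
   left inverse D. *)
Definition step_b (F : fieldType) (n : nat) (G : 'M[F]_n)
    (S L V Z : {set 'I_n}) (D : 'M[F]_(#|V|, #|L|)) : block_eq F S :=
  substitute (step_a G Z S) (solve_other D (step_a G Z L)).

(* Equation of w_L after w_V is eliminated through the equation of w_V. *)
Definition step_c (F : fieldType) (n : nat) (G : 'M[F]_n)
    (L V Z : {set 'I_n}) : block_eq F L :=
  substitute (step_a G Z L) (solve_self (step_a G Z V)).

Record abstracted_network (F : fieldType) (n : nat) (S L : {set 'I_n}) :=
  AbstractedNetwork { abs_S : block_eq F S; abs_L : block_eq F L }.

Definition abstraction (F : fieldType) (n : nat) (G : 'M[F]_n)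
    (S L V Z : {set 'I_n}) (D : 'M[F]_(#|V|, #|L|))
    : abstracted_network F S L :=
  AbstractedNetwork (remove_self_loops (step_b G S Z D))
                    (remove_self_loops (step_c G L V Z)).

(* The module from w_i to w_j in the abstracted network, for j in S. *)
Definition abs_module (F : fieldType) (n : nat) (S L : {set 'I_n})
    (N : abstracted_network F S L) (j i : 'I_n) (jS : j \in S) : F :=
  wcoef (abs_S N) (enum_rank_in jS j) i.

(* Main.v *)
(* After step (a), the coefficient of w_l in the equation of w_b is G_bl plus
   terms carried by the walks from l to b whose intermediate nodes all lie in Z.
   By (a) and (b) no such walk leads from i or j to a node of J, so the
   coefficient of w_i in the equation of w_j is still G_ji, and w_j occurs
   neither in its own equation nor, like w_i, in the equations of w_L.  Hence
   the substitution of step (b) and the division of step (d) leave the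
   coefficient of w_i in the equation of w_j unchanged. *)
Require Import Defs.
From HB Require Import structures.
From mathcomp Require Import all_boot all_order all_algebra.
From mathcomp Require Import reals.
Set Implicit Arguments.
Unset Strict Implicit.
Unset Printing Implicit Defensive.
Import Order.TTheory GRing.Theory Num.Theory.
Local Open Scope ring_scope.

(** An invertible [A] preserves rank, so the inclusion of [Q *m A] in [Q] is an equality of row
    spaces, and multiplying by [invmx A] reverses it. *)
Lemma stablemx_inv (F : fieldType) (m : nat) (Q A : 'M[F]_m) :
  A \in unitmx -> stablemx Q A -> stablemx Q (invmx A).
Proof.
move=> uA sQA; have := mxrank_leqif_eq sQA.
rewrite mxrankMfree ?row_free_unit // => -[_]; rewrite eqxx => /esym /andP[_ sQ].
by have := submxMr (invmx A) sQ; rewrite mulmxK.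
Qed.

(* The vectors supported off the set T of nodes reachable from y form a
   subspace stable under 1 - M, hence also under its inverse. *)
Lemma invmx_connect (F : fieldType) (m : nat) (M : 'M[F]_m) (x y : 'I_m) :
  1%:M - M \in unitmx -> invmx (1%:M - M) x y != 0 -> connect (link M) y x.
Proof.
move=> uM; apply: contraNT => nyx; apply/eqP.
pose T := [pred k | connect (link M) y k].
pose Q : 'M[F]_m := diag_mx (\row_k (k \notin T)%:R).
have QE (B : 'M[F]_m) a b : (Q *m B) a b = (a \notin T)%:R * B a b.
  by rewrite mul_diag_mx !mxE.
have EQ (B : 'M[F]_m) a b : (B *m Q) a b = B a b * (b \notin T)%:R.
  by rewrite mul_mx_diag !mxE.
have sQ : stablemx Q (1%:M - M).
  (* [Q] projects onto the coordinates outside [T]. The witness works because no link leaves [T]: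
     [M a b] vanishes for [b] in [T] and [a] outside. *)
  apply/submxP; exists (Q *m (1%:M - M)); apply/matrixP => a b.
  rewrite EQ QE; have [bT|_] := boolP (b \in T); last by rewrite mulr1.
  rewrite mulr0; have [_|aT] := boolP (a \in T); first by rewrite mul0r.
  have ab : a != b by apply: contraNneq aT => ->.
  have Mab : M a b = 0.
    apply/eqP; apply: contraNT aT => Mab.
    by apply: connect_trans bT _; apply: connect1.
  by rewrite !mxE Mab (negbTE ab) subr0 mulr0.
(* Column [y] of [B *m Q] is zero since [y] lies in [T], while row [x] of the inverse survives the
   projection. *)
have /submxP[B /matrixP /(_ x y)] := stablemx_inv uM sQ.
by rewrite QE EQ inE nyx mul1r inE connect0 mulr0.
Qed.

Section AbstractionCoefficients.
Variables (F : fieldType) (n : nat) (G : 'M[F]_n).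

(** With [K] the inverse of [1 - G_ZZ], a nonzero term [G_ax K_xy G_yl] of the correction would, by
    [invmx_connect], yield a walk from [l] to [y], inside [Z] to [x], and on to [a]. *)
Lemma wcoef_step_a (Z A : {set 'I_n}) (a : 'I_#|A|) (l : 'I_n) :
    1%:M - submx_of G Z Z \in unitmx -> l \notin Z ->
    (forall p, p != [::] -> {subset p <= Z} ->
       ~~ path (link G) l (rcons p (enum_val a))) ->
  wcoef (step_a G Z A) a l = G (enum_val a) l.
Proof.
move=> uZ lZ noZ; rewrite /= !mxE (negbTE lZ).
rewrite big1 ?addr0 // => x _; rewrite !mxE mulr_sumr big1 // => y _.
rewrite !mxE (negbTE lZ); apply/eqP.
rewrite !mulf_eq0; apply: contraT; rewrite !negb_or => /and3P[Gax Kxy Gyl].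
have ZZ : sel_cols Z (sel_rows Z G) = submx_of G Z Z.
  by apply/matrixP => ? ?; rewrite !mxE.
rewrite ZZ in Kxy; have /connectP[p yp xE] := invmx_connect uZ Kxy.
have pZ : {subset map enum_val (y :: p) <= Z}.
  by move=> _ /mapP[z _ ->]; apply: enum_valP.
apply: contraLR (noZ (map enum_val (y :: p)) isT pZ) => _.
rewrite negbK.
rewrite rcons_path /= {1}/link Gyl last_map -xE {2}/link Gax andbT.
rewrite path_map; apply: sub_path yp => k1 k2.
by rewrite /link /= mxE.
Qed.

(** The expression found for [w_V] involves [w_l] only through the left-hand side [w_L], excluded by
    [l \notin L], or through the right-hand side of that equation, where its coefficient is zero. *)
Lemma wcoef_step_b (S L V Z : {set 'I_n}) (D : 'M[F]_(#|V|, #|L|))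
    (a : 'I_#|S|) (l : 'I_n) :
    l \notin L -> l \notin V ->
    (forall b, wcoef (step_a G Z L) b l = 0) ->
  wcoef (step_b G S Z D) a l = wcoef (step_a G Z S) a l.
Proof.
move=> lL lV Ll0; rewrite /step_b.
move: (step_a G Z S) (step_a G Z L) Ll0 => eS eL Ll0.
rewrite /= !mxE (negbTE lV) big1 ?addr0 // => x _.
rewrite [X in _ * X]mxE big1 ?mulr0 // => y _.
rewrite !mxE (negbTE lV) Ll0 subr0.
have /negbTE-> : enum_val y != l.
  by apply: contraNneq lL => <-; apply: enum_valP.
by rewrite mulr0.
Qed.

End AbstractionCoefficients.

Theorem theorem14 (R : realType) (n nr ne : nat)
    (N : dynamic_network R n nr ne) (i j : 'I_n) (neq_ij : i != j)
    (S L V Z : {set 'I_n}) (part : is_partition4 S L V Z)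
    (iS : i \in S) (jS : j \in S)
    (unit_Z : 1%:M - submx_of (net_G N) Z Z \in unitmx)
    (indirect_obs : \rank (G1 (net_G N) Z L V) = #|V|)
    (unit_V : 1%:M - G1 (net_G N) Z V V \in unitmx)
    (D : 'M[ratfun R]_(#|V|, #|L|))
    (left_inv : D *m G1 (net_G N) Z L V = 1%:M)
    (self_S : forall a, 1 - self_coef (step_b (net_G N) S Z D) a != 0)
    (self_L : forall a, 1 - self_coef (step_c (net_G N) L V Z) a != 0) :
  let J := j |: L in
  let K := (V :|: S) :\ j in
  (forall b p, b \in J -> is_path (net_G N) i b p -> i :: p <> [:: i; j] ->
     exists2 k, k \in K :\ i & k \in i :: p) ->
  (forall b p, b \in J -> is_path (net_G N) j b p ->
     exists2 k, k \in K & k \in j :: p) ->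
  abs_module (abstraction (net_G N) S Z D) i jS = net_G N j i.
Proof.
move=> J K pathi pathj; case: part => _ [dSL dVZ] dSLVZ.
set G := net_G N in unit_Z pathi pathj *.
have SnotL l : l \in S -> l \notin L by move/(disjointFr dSL)->.
have SLnotVZ l : l \in S :|: L -> (l \notin V) && (l \notin Z).
  by move/(disjointFr dSLVZ)/negbT; rewrite inE negb_or.
have SnotVZ l : l \in S -> (l \notin V) && (l \notin Z).
  by move=> lS; apply: SLnotVZ; rewrite inE lS.
have ZnotK z : z \in Z -> z \notin K.
  move=> zZ; rewrite !inE (disjointFl dVZ zZ) /= negb_and orbC.
  by apply/orP; left; apply: contraL zZ => /SnotVZ/andP[].
have JnotK b : b \in J -> b \notin K.
  rewrite !inE => /orP[/eqP->|bL]; first by rewrite eqxx.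
  have /SLnotVZ/andP[/negbTE-> _] : b \in S :|: L by rewrite inE bL orbT.
  by rewrite (disjointFl dSL bL) andbF.
have pathE l b p : path (link G) l (rcons p b) -> is_path G l b (rcons p b).
  by move=> lpb; rewrite /is_path lpb last_rcons eqxx; case: (p).
(* Walks through [Z] ending in [J] can meet [K] only at their starting node. *)
have no_K b p k : b \in J -> {subset p <= Z} -> k \in K -> k \notin rcons p b.
  move=> bJ pZ kK; rewrite mem_rcons inE negb_or; apply/andP; split.
    by apply: contraTneq kK => ->; apply: JnotK.
  by apply: contraL kK => /pZ; apply: ZnotK.
(* The start [i] may lie in [K], but condition (a) asks for a node of [K :\ i]. *)
have noi b p : b \in J -> {subset p <= Z} -> rcons p b != [:: j] ->
    ~~ path (link G) i (rcons p b).
  move=> bJ pZ pj; apply/negP => /pathE ip.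
  have ip_j : i :: rcons p b <> [:: i; j] by case=> /eqP; apply/negP.
  have [k] := pathi b _ bJ ip ip_j.
  rewrite in_setD1 => /andP[ki kK].
  by rewrite inE (negbTE ki) (negbTE (no_K _ _ _ bJ pZ kK)).
have noj b p : b \in J -> {subset p <= Z} -> ~~ path (link G) j (rcons p b).
  move=> bJ pZ; apply/negP => /pathE jp.
  have [k kK] := pathj b _ bJ jp.
  rewrite inE (negbTE (no_K _ _ _ bJ pZ kK)) orbF => /eqP kj.
  by move: kK; rewrite kj !inE eqxx.
have rconsN1 (b : 'I_n) p : p != [::] -> rcons p b != [:: j].
  apply: contra_neq => /(congr1 size) /eqP.
  by rewrite size_rcons eqSS => /nilP.
have jJ : j \in J by rewrite !inE eqxx.
have LJ (b : 'I_#|L|) : enum_val b \in J by rewrite inE enum_valP orbT.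
have [iV iZ] := andP (SnotVZ i iS); have [jV jZ] := andP (SnotVZ j jS).
have Li b : wcoef (step_a G Z L) b i = 0.
  (* Hence a link from [i] to this node is not the exempted direct path. *)
  have bj : enum_val b != j.
    by apply: contraNneq (SnotL j jS) => <-; apply: enum_valP.
  rewrite wcoef_step_a //.
    apply/eqP; have := noi _ [::] (LJ b); rewrite /= andbT /link negbK; apply=> //.
    by apply: contraNneq bj => -[->].
  by move=> p p0 pZ; apply: noi => //; apply: rconsN1.
have Lj b : wcoef (step_a G Z L) b j = 0.
  rewrite wcoef_step_a // => [|p _ pZ]; last exact: noj.
  by apply/eqP; have := noj _ [::] (LJ b); rewrite /= andbT /link negbK; apply.
have jE : enum_val (enum_rank_in jS j) = j by rewrite enum_rankK_in.
rewrite /abs_module /abstraction /remove_self_loops [abs_S _]/= [LHS]mxE.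
rewrite /self_coef jE (negbTE neq_ij).
rewrite !wcoef_step_b ?SnotL // !wcoef_step_a ?jE //.
(* The self-coefficient has become [G j j], which is 0, so the divisor is 1. *)
- by rewrite net_no_self_loop subr0 divr1.
- by move=> p _ pZ; apply: noj.
- by move=> p p0 pZ; apply: noi => //; apply: rconsN1.
Qed.
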